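(* Let $\Bbbk$ be a field and $n\ge 1$. For $M\in M_n(\Bbbk)$ put $A *_M B = AMB$. 1) Let $M\in M_n(\Bbbk)$ with $\det M\neq 0$. Then $(\mathrm{GL}_n(\Bbbk), *_M)$ is a group, whose unit element is $M^{-1}$ and in which the inverse of $A\in \mathrm{GL}_n(\Bbbk)$ is $M^{-1}A^{-1}M^{-1}$ (here $^{-1}$ denotes the ordinary matrix inverse). 2) The algebraic system $(\mathrm{GL}_n(\Bbbk), *_M,\ M\in \mathrm{GL}_n(\Bbbk))$ is a multi-group.
   Context: $M_n(\Bbbk)$ is the set of $n\times n$ matrices over the field $\Bbbk$. A group system is a set $G$ with a family of binary operations $(G, *_i, i\in I)$ such that $(G,*_i)$ is a group for every $i\in I$. A group system is called a multi-group if $$(a *_i b) *_j c = a *_i (b *_j c)\quad\text{for all } a,b,c\in G,\ i,j\in I.$$ *)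

(* Defs.v *)
From mathcomp Require Import all_boot all_order all_algebra.

Set Implicit Arguments.
Unset Strict Implicit.
Unset Printing Implicit Defensive.

Import GRing.Theory.
Local Open Scope ring_scope.

(* Several group laws live on one set G, so groups are described here by a    *)
(* predicate on a binary operation rather than by the canonical structure     *)
(* groupType. The set G is a subset of an ambient type T (with G := predT     *)
(* giving the whole type), hence the explicit closure conditions.             *)
Section GroupSystems.

Variables (T : Type) (G : {pred T}).

Definition is_identity (op : T -> T -> T) (e : T) : Prop :=
  [/\ e \in G, {in G, left_id e op} & {in G, right_id e op}].

Definition is_inverse (op : T -> T -> T) (e a b : T) : Prop :=
  [/\ b \in G, op b a = e & op a b = e].

Definition is_group (op : T -> T -> T) : Prop :=
  [/\ {in G &, forall a b, op a b \in G},
      {in G & &, associative op}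
    & exists2 e, is_identity op e
               & {in G, forall a, exists b, is_inverse op e a b}].

Variables (J : Type) (I : {pred J}) (op : J -> T -> T -> T).

Definition is_group_system : Prop := {in I, forall i, is_group (op i)}.

Definition is_multi_group : Prop :=
  is_group_system /\
  {in I &, forall i j, {in G & &, forall a b c,
    op j (op i a b) c = op i a (op j b c)}}.

End GroupSystems.

Definition sandwich (k : fieldType) (n : nat) (M A B : 'M[k]_n) : 'M[k]_n :=
  A *m M *m B.

(* Main.v *)
Require Import Defs.
From mathcomp Require Import all_boot all_order all_algebra.

(** The associativity of the matrix product gives [A M (B N C) = (A M B) N C]:
    this mixed law is the compatibility
    required of a multi-group, and its case [M = N] is the associativity of
    each single sandwich product. Invertible matrices are closed under products
    and inverses, so it remains to cancel: in [M^-1 M A] and [A M M^-1] for the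
    identity, and in [(M^-1 A^-1 M^-1) M A] and [A M (M^-1 A^-1 M^-1)] for the
    inverses. Put differently, [A |-> A M] carries the sandwich product by [M]
    to the usual product, hence the identity is the preimage [M^-1] of [1] and
    the inverse of [A] is the preimage [(A M)^-1 M^-1] of [(A M)^-1]. *)

Local Open Scope ring_scope.

Lemma sandwichA (k : fieldType) (n : nat) (M N A B C : 'M[k]_n) :
  sandwich N (sandwich M A B) C = sandwich M A (sandwich N B C).
Proof. by rewrite /sandwich !mulmxA. Qed.

Lemma sandwich_unitmx (k : fieldType) (n : nat) (M A B : 'M[k]_n) :
  M \in unitmx -> A \in unitmx -> B \in unitmx -> sandwich M A B \in unitmx.
Proof. by move=> uM uA uB; rewrite !unitmx_mul uA uM uB. Qed.

Lemma sandwich_identity (k : fieldType) (n : nat) (M : 'M[k]_n) :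
  M \in unitmx -> is_identity (@unitmx k n) (sandwich M) (invmx M).
Proof.
move=> uM; split=> [|A _|A _]; first by rewrite unitmx_inv.
- by rewrite /sandwich mulVmx // mul1mx.
- by rewrite /sandwich mulmxK.
Qed.

Lemma sandwich_inverse (k : fieldType) (n : nat) (M A : 'M[k]_n) :
  M \in unitmx -> A \in unitmx ->
  is_inverse (@unitmx k n) (sandwich M) (invmx M) A
    (invmx M *m invmx A *m invmx M).
Proof.
move=> uM uA; split; rewrite /sandwich.
- by rewrite [_ \in _]unitmx_mul unitmx_mul !unitmx_inv uM uA.
- by rewrite !mulmxKV.
- by rewrite !mulmxA mulmxK // mulmxV // mul1mx.
Qed.

Lemma sandwich_group (k : fieldType) (n : nat) (M : 'M[k]_n) :
  M \in unitmx -> is_group (@unitmx k n) (sandwich M).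
Proof.
move=> uM; split=> [A B uA uB|A B C _ _ _|].
- exact: sandwich_unitmx.
- by rewrite sandwichA.
- exists (invmx M); first exact: sandwich_identity.
  move=> A uA; exists (invmx M *m invmx A *m invmx M).
  exact: sandwich_inverse.
Qed.

Theorem theorem3p6 (k : fieldType) (n : nat) (hn : (1 <= n)%N) :
  (forall M : 'M[k]_n, \det M != 0 ->
     [/\ is_group (@unitmx k n) (sandwich M),
         is_identity (@unitmx k n) (sandwich M) (invmx M)
       & forall A : 'M[k]_n, A \in unitmx ->
           is_inverse (@unitmx k n) (sandwich M) (invmx M) A
             (invmx M *m invmx A *m invmx M)])
  /\ is_multi_group (@unitmx k n) (@unitmx k n) (@sandwich k n).
Proof.
split=> [M detM|].
- have uM : M \in unitmx by rewrite unitmxE GRing.unitfE.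
  split=> [||A uA]; first exact: sandwich_group.
  + exact: sandwich_identity.
  + exact: sandwich_inverse.
- split=> [M uM|M N _ _ A B C _ _ _]; first exact: sandwich_group.
  exact: sandwichA.
Qed.
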